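(* Let $\Gamma=\{v_1,\ldots,v_n\}$ be an abelian group with $|\Gamma|=n$, let $S\subseteq\Gamma$ with $-S=S$, and suppose that $G=\operatorname{Cay}(\Gamma,S)$ is an integral Cayley graph over $\Gamma$. Let $d_0=0<d_1<\cdots<d_r$ be the sequence of distances occurring between vertices of $G$ (possibly $d_r=\infty$). Then for every vector $k=(k_0,\ldots,k_r)$ with integer entries, the generalized distance matrix $\operatorname{DM}(k,G)$ has integral spectrum, i.e. all its eigenvalues are integers. Moreover, if $\psi_1,\ldots,\psi_n$ are the distinct characters of $\Gamma$, then the vectors $(\psi_i(v_j))_{j=1,\ldots,n}$, $1\le i\le n$, form an orthogonal basis of $\mathbb{C}^n$ (with respect to the standard inner product) consisting of eigenvectors of $\operatorname{DM}(k,G)$.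
   Context: Groups are written additively. For a finite group $\Gamma$ and $S\subseteq\Gamma$ with $-S=\{-s: s\in S\}=S$, the undirected Cayley graph $\operatorname{Cay}(\Gamma,S)$ has vertex set $\Gamma$, and vertices $a,b\in\Gamma$ are adjacent if and only if $a-b\in S$ ($0\in S$ is allowed and produces a loop at every vertex). A graph is integral if all eigenvalues of its adjacency matrix are integers (a loop contributes a diagonal entry $1$). A character of $\Gamma$ is a homomorphism $\psi:\Gamma\to\mathbb{C}\setminus\{0\}$ into the multiplicative group of complex numbers; a finite abelian group of order $n$ has exactly $n$ characters. For vertices $x,y$ of a graph $G$, $d(x,y)$ is the usual graph distance, with $d(x,x)=0$ and $d(x,y)=\infty$ if $x,y$ lie in different connected components. Given an undirected graph $G$ with vertices $v_1,\ldots,v_n$, let $d_0=0<d_1<\cdots<d_r$ be the sequence of distances occurring between vertices of $G$ (possibly $d_r=\infty$). For a vector $k=(k_0,\ldots,k_r)$ with integer entries, the generalized distance matrix $\operatorname{DM}(k,G)=(d^{(k)}_{i,j})_{1\le i,j\le n}$ is defined by $d^{(k)}_{i,j}=k_t$ if $d(v_i,v_j)=d_t$. *)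

(* Defs.v *)
From HB Require Import structures.
From mathcomp Require Import all_boot all_order all_algebra.
From mathcomp Require Import reals.
From mathcomp.real_closed Require Import complex.

Set Implicit Arguments.
Unset Strict Implicit.
Unset Printing Implicit Defensive.

Import Order.TTheory GRing.Theory Num.Theory.

Local Open Scope ring_scope.

(* An undirected graph, possibly with loops, is a symmetric [e : rel T].
   Distances live in [option nat], with [None] for the distance infinity. *)
Section Distance.
Variables (T : finType) (e : rel T).

Definition has_walk (x y : T) (m : nat) : bool :=
  [exists p : m.-tuple T, path e x p && (last x p == y)].

Lemma connect_walk x y : connect e x y -> exists m, has_walk x y m.
Proof.
case/connectP=> p e_p ->; exists (size p).
by apply/existsP; exists (in_tuple p); rewrite e_p eqxx.
Qed.

Definition gdist (x y : T) : option nat :=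
  if @idP (connect e x y) is ReflectT xy then Some (ex_minn (connect_walk xy))
  else None.

Definition enat_le (a b : option nat) : bool :=
  match a, b with
  | _, None => true
  | None, Some _ => false
  | Some m, Some n => (m <= n)%N
  end.

(* d_0 < d_1 < ... < d_r, so that the size is r + 1. *)
Definition distances : seq (option nat) :=
  sort enat_le (undup [seq gdist x y | x <- enum T, y <- enum T]).

Lemma gdistP x y :
  match gdist x y with
  | Some m => has_walk x y m /\ (forall l, has_walk x y l -> (m <= l)%N)
  | None => forall l, ~~ has_walk x y l
  end.
Proof.
rewrite /gdist; case: {-}_ / idP => [xy | xy]; first by case: ex_minnP.
move=> l; apply/negP => /existsP[p /andP[e_p /eqP p_y]]; apply: xy.
by apply/connectP; exists p.
Qed.

Lemma gdistxx x : gdist x x = Some 0%N.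
Proof.
have w0 : has_walk x x 0 by apply/existsP; exists [tuple]; rewrite /= eqxx.
have := gdistP x x; case: (gdist x x) => [m [_ /(_ _ w0)]|/(_ 0%N)].
  by rewrite leqn0 => /eqP ->.
by rewrite w0.
Qed.

Lemma mem_distances a :
  reflect (exists x y, a = gdist x y) (a \in distances).
Proof.
rewrite mem_sort mem_undup; apply: (iffP allpairsP) => [[[x y] /= [_ _ ->]]|].
  by exists x, y.
by case=> x [y ->]; exists (x, y); split; rewrite ?mem_enum.
Qed.

Lemma uniq_distances : uniq distances.
Proof. by rewrite sort_uniq undup_uniq. Qed.

Lemma sorted_distances : sorted enat_le distances.
Proof. by apply: sort_sorted => -[m|] [n|] //=; exact: leq_total. Qed.

End Distance.

Section GraphMatrices.
Variables (F : fieldType) (T : finType) (e : rel T) (n : nat) (v : 'I_n -> T).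

Definition adj_mx : 'M[F]_n := \matrix_(i, j) (e (v i) (v j))%:R.

(* DM(k, G), for the enumeration v of the vertices: the (i, j) entry is k_t
   for the position t of d(v_i, v_j) in the sequence of distances. *)
Definition gen_dist_mx (k : (size (distances e)).-tuple int) : 'M[F]_n :=
  \matrix_(i, j) (nth 0 k (index (gdist e (v i) (v j)) (distances e)))%:~R.

End GraphMatrices.

Definition integral_spectrum (F : fieldType) (n : nat) (A : 'M[F]_n) : Prop :=
  forall a : F, eigenvalue A a -> exists z : int, a = z%:~R.

(* Vectors of F^n are rows, as for [eigenvalue] and [dotmx], but a matrix acts
   on them as columns, as usual outside the library; the eigenvalues are the
   same for both actions. *)
Definition is_eigenvector (F : fieldType) (n : nat) (A : 'M[F]_n)
    (x : 'rV[F]_n) : Prop :=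
  x != 0 /\ exists a : F, A *m x^T = a *: x^T.

(* [basis_of] is the library's notion of basis of a vector space, and [dotmx]
   the standard Hermitian inner product. *)
Definition orthogonal_basis (C : numClosedFieldType) (n : nat)
    (x : 'I_n -> 'rV[C]_n) : Prop :=
  basis_of fullv [seq x i | i : 'I_n] /\
  forall i j : 'I_n, i != j -> dotmx (x i) (x j) = 0.

Definition cayley (V : finZmodType) (S : {set V}) : rel V :=
  fun a b => a - b \in S.

(* Finite functions are used so that distinct characters are distinct as
   terms. *)
Definition is_character (F : fieldType) (V : finZmodType)
    (psi : {ffun V -> F}) : Prop :=
  (forall a, psi a != 0) /\ (forall a b, psi (a + b) = psi a * psi b).

(* Main.v *)
Require Import Defs.
From HB Require Import structures.
From mathcomp Require Import all_boot all_order all_algebra all_field.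
From mathcomp Require Import fingroup cyclic zify.
From mathcomp Require Import reals.
From mathcomp.real_closed Require Import complex.

Set Implicit Arguments.
Unset Strict Implicit.
Unset Printing Implicit Defensive.

Import Order.TTheory GRing.Theory Num.Theory.

Local Open Scope ring_scope.

(** Number the group as [v] and call [conv_mx v f] the matrix with entries
[f (v i - v j)].  The adjacency matrix is of this form, and so is the distance
matrix, because translations are automorphisms of a Cayley graph.  Every
character [psi] is an eigenvector of every such matrix, for the eigenvalue
[\sum_x f x * psi (- x)]; characters are pairwise orthogonal, and this gives
the statement about bases.

For the spectrum, the eigenvalues of [conv_mx v f] are exactly the character
sums [\sum_x f x * psi x].  That there are no others, and that a function
whose character sums all vanish is zero, both rest on
[characters_separate]: the matrices [conv_mx v f] commute and are normal, so
the translations can be diagonalized together, and a common eigenvector of all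
translations is a multiple of a character.

What remains is a Galois argument over the field generated by a primitive root
of unity [z] of order [#|V|].  The values of a character are powers of [z], so a
character sum of an integer-valued function is [P(z)] for an integer
polynomial [P], and replacing [x] by [x *+ m] inside [psi] replaces [z] by
[z ^+ m], a conjugate of [z] when [m] is prime to the order.
- If all character sums of [F] are integers, conjugation fixes them, so [F] and
  [x |-> F (x *+ m)] have the same character sums and are equal
  ([mulrn_invariant]).  Hence integrality of the graph forces
  [(x *+ m \in S) = (x \in S)].
- Then [x |-> x *+ m] is an automorphism of the graph, so the distance from [0]
  is invariant under it as well ([gdist_cayley_mulrn]).
- Conversely the character sums of an invariant [F] are fixed under
  conjugation, hence are integers ([character_sum_int]). *)

(** * Primitive roots of unity and integer polynomials *)

Section RootsOfUnity.

Lemma prim_root_exists (C : numClosedFieldType) n :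
  (0 < n)%N -> exists z : C, n.-primitive_root z.
Proof.
move=> n_gt0; have [r Dp] := closed_field_poly_normal ('X^n - 1 : {poly C}).
move: Dp; rewrite (monicP _) ?monicXnsubC // scale1r => Dp.
have rn1 : all n.-unity_root r.
  by apply/allP=> z; rewrite -root_prod_XsubC -Dp.
have sz_r : (n <= size r)%N.
  by rewrite -ltnS -(size_XnsubC (1 : C) n_gt0) Dp size_prod_XsubC.
suff /(has_prim_root n_gt0 rn1)/(_ sz_r)/hasP[z _ zP] : uniq r by exists z.
by rewrite -separable_prod_XsubC -Dp separable_Xn_sub_1 // pnatr_eq0 -lt0n.
Qed.

(** The polynomial ['X^n - 1] is the product of the ['Phi_d] for [d %| n], and
the order of a root of ['Phi_d] divides [d]; so a primitive [n]-th root can only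
come from the factor [d = n]. *)
Lemma root_Cyclotomic (F : numFieldType) n (z : F) :
  n.-primitive_root z -> root (map_poly intr 'Phi_n) z.
Proof.
move=> z_prim; have n_gt0 := prim_order_gt0 z_prim.
have root_prod m y : (0 < m)%N ->
    y ^+ m = 1 <->
    exists2 d, (d %| m)%N & root (map_poly intr 'Phi_d : {poly F}) y.
  move=> m_gt0; have -> : y ^+ m = 1 <-> root ('X^m - 1 : {poly F}) y.
    by rewrite -[root _ _]/(m.-unity_root y); split=> /unity_rootP.
  have -> : 'X^m - 1 = \prod_(d <- divisors m) map_poly intr 'Phi_d :> {poly F}.
    rewrite -rmorph_prod prod_Cyclotomic // rmorphB rmorph1 /=.
    by rewrite map_polyXn.
  rewrite rootE horner_prod prodf_seq_eq0; split=> [/hasP[d]|[d d_m Phi_d_y]].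
    by rewrite -dvdn_divisors // => d_m; exists d.
  by apply/hasP; exists d; rewrite -?dvdn_divisors.
have [d d_n Phi_d_z] := (root_prod _ _ n_gt0).1 (prim_expr_order z_prim).
have d_gt0 := dvdn_gt0 n_gt0 d_n.
have : z ^+ d = 1 by apply/(root_prod _ _ d_gt0); exists d.
move/eqP; rewrite -(prim_order_dvd z_prim) => n_d.
by rewrite (_ : n = d) //; apply/eqP; rewrite eqn_dvd n_d.
Qed.

(** All primitive [n]-th roots have the same minimal polynomial ['Phi_n] over
the rationals.  Minimality, hence irreducibility, is known for a root [w] in
[algC]; it is a statement about rational polynomials and so carries over to
[F]. *)
Lemma root_prim_root_conj (F : numFieldType) n (z y : F) (P : {poly int}) :
  n.-primitive_root z -> n.-primitive_root y ->
  root (map_poly intr P) z -> root (map_poly intr P) y.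
Proof.
move=> z_prim y_prim Pz; have n_gt0 := prim_order_gt0 z_prim.
have intrQ (K : numFieldType) (p : {poly int}) :
    map_poly ratr (map_poly intr p : {poly rat}) = map_poly intr p :> {poly K}.
  by rewrite -map_poly_comp; apply: eq_map_poly => b; rewrite /= ratr_int.
have [w w_prim] := C_prim_root_exists n_gt0.
have [p [Dp p_monic] p_dvd] := minCpolyP w.
have {}Dp : p = map_poly intr 'Phi_n.
  apply: (map_poly_inj (ratr : {rmorphism rat -> algC})).
  by rewrite -Dp (minCpoly_cyclotomic w_prim) intrQ -(Cintr_Cyclotomic w_prim).
have p_neq0 := monic_neq0 p_monic.
have root_p x : n.-primitive_root x -> root (map_poly ratr p : {poly F}) x.
  by move=> x_prim; rewrite Dp intrQ root_Cyclotomic.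
pose q : {poly rat} := map_poly intr P.
have [/dvdpP[r Dq] | p_n_dvd] := boolP (p %| q).
  by rewrite -intrQ -/q Dq rmorphM rootM root_p ?orbT.
(* Otherwise w is a root of gcd(p, q) or of its cofactor h; the former would
   make p divide q, and the latter forces the gcd to be constant. *)
have [h Dh] := dvdpP _ _ (dvdp_gcdl p q).
have : root (map_poly ratr p) w by rewrite p_dvd.
rewrite {1}Dh rmorphM rootM !p_dvd => /orP[p_h|]; last first.
  by move/dvdp_trans/(_ (dvdp_gcdr p q)); rewrite (negPf p_n_dvd).
have cop : coprimep p q.
  have := p_neq0; rewrite {1}Dh mulf_eq0 => /norP[h_neq0 g_neq0].
  have := dvdp_leq h_neq0 p_h; rewrite {1}Dh size_mul // /coprimep.
  move: g_neq0 h_neq0; rewrite -!size_poly_gt0; lia.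
have := cop; rewrite -(coprimep_map (ratr : {rmorphism rat -> F})).
move=> /coprimep_root/(_ (root_p _ z_prim)).
by rewrite intrQ (rootP Pz) eqxx.
Qed.

(** The remainder of [P] modulo ['Phi_n] still takes the value [c] at all
[totient n] primitive roots, and its degree is smaller than [totient n].  It is
therefore the constant [c]; since ['Phi_n] is monic its coefficients are
integers. *)
Lemma horner_prim_root_int (F : numFieldType) n (z c : F) (P : {poly int}) :
  n.-primitive_root z ->
  (forall y, n.-primitive_root y -> (map_poly intr P).[y] = c) ->
  exists a : int, c = a%:~R.
Proof.
move=> z_prim Pc; pose r := Pdiv.Ring.rmodp P 'Phi_n.
have Dp := Pdiv.RingMonic.rdivp_eq (Cyclotomic_monic n) P.
have r_c y : n.-primitive_root y -> (map_poly intr r).[y] = c.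
  move=> y_prim; rewrite -(Pc y y_prim) [in RHS]Dp.
  rewrite rmorphD rmorphM hornerD hornerM.
  by rewrite (rootP (root_Cyclotomic y_prim)) mulr0 add0r.
exists r`_0; suff : map_poly intr r - c%:P = 0.
  move=> /polyP/(_ 0%N)/eqP; rewrite coefB coef_map coefC coef0 subr_eq0.
  by move=> /eqP.
pose s := [seq z ^+ k | k : 'I_n in [pred k : 'I_n | coprime k n]].
have roots_s : all (root (map_poly intr r - c%:P)) s.
  apply/allP=> _ /imageP[k k_n ->]; rewrite rootE hornerD hornerN hornerC.
  by rewrite r_c ?subrr // prim_root_exp_coprime.
apply: (roots_geq_poly_eq0 roots_s).
  rewrite map_inj_in_uniq ?enum_uniq // => i j _ _ /eqP.
  by rewrite (eq_prim_root_expr z_prim) !modn_small // => /eqP/val_inj.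
have -> : size s = totient n.
  apply: succn_inj; rewrite -(size_cyclotomic z) -(size_prod_XsubC s id).
  by rewrite big_image.
rewrite (leq_trans (size_polyD _ _)) // geq_max size_polyN size_polyC.
rewrite (leq_trans (leq_b1 _)) ?totient_gt0 ?(prim_order_gt0 z_prim) // andbT.
rewrite (leq_trans (size_poly _ _)) // -ltnS -(size_Cyclotomic n).
by rewrite Pdiv.Ring.ltn_rmodpN0 // monic_neq0 // Cyclotomic_monic.
Qed.

End RootsOfUnity.

(** * Distances and graph automorphisms *)

Section GraphAutomorphisms.
Variables (T : finType) (e : rel T) (g : T -> T).
Hypotheses (g_bij : bijective g) (g_aut : forall x y, e (g x) (g y) = e x y).

Lemma has_walk_aut x y m : has_walk e (g x) (g y) m = has_walk e x y m.
Proof.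
have [h gK hK] := g_bij.
have path_g p : path e (g x) (map g p) = path e x p.
  by rewrite path_map; apply: eq_path => a b; apply: g_aut.
apply/existsP/existsP=> -[p /andP[e_p /eqP p_y]].
  exists (map_tuple h p); rewrite -path_g -(can_eq gK) -last_map.
  by rewrite !mapK ?e_p ?p_y //= mapK.
by exists (map_tuple g p); rewrite path_g e_p last_map p_y eqxx.
Qed.

Lemma gdist_aut x y : gdist e (g x) (g y) = gdist e x y.
Proof.
have := gdistP e x y; have := gdistP e (g x) (g y).
case: gdist => [a|]; case: gdist => [b|] //.
- move=> [gWa a_min] [Wb b_min]; congr Some; apply/eqP; rewrite eqn_leq.
  by rewrite a_min ?b_min // ?has_walk_aut // -has_walk_aut.
- by move=> [gWa _] /(_ a)/negP; rewrite -has_walk_aut.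
- by move=> /(_ b)/negP; rewrite has_walk_aut => nW [].
Qed.

End GraphAutomorphisms.

Lemma gdist_cayley (V : finZmodType) (S : {set V}) x y :
  gdist (cayley S) x y = gdist (cayley S) (x - y) 0.
Proof.
rewrite -[in RHS](subrr y) (gdist_aut (g := +%R^~ (- y))) // => [|a b].
  by exists (fun z => z + y) => z; rewrite ?subrK ?addrK.
by rewrite /cayley opprB addrA subrK.
Qed.

Lemma mulrn_bij (V : finZmodType) m :
  coprime #|V| m -> bijective (fun x : V => x *+ m).
Proof.
rewrite -cardsT => V_m; apply: injF_bij => x y /= xy.
have K (z : V) : (z *+ m) *+ expg_invn [set: V] m = z.
  by rewrite -!FinRing.Theory.zmodXgE expgK ?in_setT.
by rewrite -(K x) -(K y) xy.
Qed.

(** Multiplication by [m] is an automorphism both of the group and, by the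
hypothesis on [S], of the graph. *)
Lemma gdist_cayley_mulrn (V : finZmodType) (S : {set V}) m x :
    coprime #|V| m -> (forall y, (y *+ m \in S) = (y \in S)) ->
  gdist (cayley S) (x *+ m) 0 = gdist (cayley S) x 0.
Proof.
move=> V_m S_m; rewrite -{1}(mul0rn _ m).
rewrite (gdist_aut (g := fun z => (z *+ m))) //; first exact: mulrn_bij.
by move=> a b; rewrite /cayley -mulrnBl S_m.
Qed.

(** * Character sums *)

Section Characters.
Variables (C : numClosedFieldType) (V : finZmodType).
Implicit Types (psi phi : {ffun V -> C}) (f : V -> C) (x y : V).

Lemma character0 psi : is_character psi -> psi 0 = 1.
Proof.
move=> [psi_neq0 psiD]; apply: (mulfI (psi_neq0 0)).
by rewrite mulr1 -psiD addr0.
Qed.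

Lemma characterN psi x : is_character psi -> psi (- x) = (psi x)^-1.
Proof.
move=> psiP; have [psi_neq0 psiD] := psiP; apply: (mulfI (psi_neq0 x)).
by rewrite divff // -psiD subrr character0.
Qed.

Lemma characterMn psi x m : is_character psi -> psi (x *+ m) = psi x ^+ m.
Proof.
move=> psiP; have [_ psiD] := psiP.
elim: m => [|m IHm]; first by rewrite mulr0n character0.
by rewrite mulrS exprS psiD IHm.
Qed.

Lemma character_unity psi x : is_character psi -> psi x ^+ #|V| = 1.
Proof.
move=> psiP; rewrite -characterMn // -FinRing.Theory.zmodXgE.
by rewrite -cardsT expg_cardG ?inE // [1%g]/(0 : V) character0.
Qed.

Lemma character_conj psi x : is_character psi -> (psi x)^* = psi (- x).
Proof.
move=> psiP; rewrite characterN // invC_norm.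
suff -> : `|psi x| = 1 by rewrite expr1n invr1 mul1r.
have V_gt0 : (0 < #|V|)%N by apply/card_gt0P; exists 0.
apply: (pexpIrn V_gt0); rewrite ?nnegrE //.
by rewrite -normrX character_unity // normr1 expr1n.
Qed.

Lemma character_inv psi :
  is_character psi -> is_character [ffun x => psi (- x)].
Proof.
move=> [psi_neq0 psiD]; split=> [x|x y]; first by rewrite ffunE.
by rewrite !ffunE opprD psiD.
Qed.

(** Translating the summation variable by [a] multiplies the sum by
[psi a / phi a], which differs from [1] for a suitable [a]. *)
Lemma character_orthogonal psi phi :
    is_character psi -> is_character phi -> psi != phi ->
  \sum_x psi x * (phi x)^* = 0.
Proof.
move=> psiP phiP psi_phi; have [_ psiD] := psiP; have [phi_neq0 phiD] := phiP.
have [a psi_phi_a] : exists a, psi a != phi a.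
  apply/existsP; apply: contraNT psi_phi; rewrite negb_exists => /forallP eq_pp.
  by apply/eqP/ffunP=> x; apply/eqP; rewrite -[_ == _]negbK eq_pp.
set s := LHS; have Ds : s = psi a * phi (- a) * s.
  rewrite mulr_sumr /s (reindex_inj (addrI a)); apply: eq_bigr => x _.
  by rewrite !character_conj // opprD psiD phiD mulrACA.
apply/eqP; apply: contraNT psi_phi_a => s_neq0.
have : psi a * phi (- a) = 1 by apply: (mulIf s_neq0); rewrite -Ds mul1r.
by rewrite characterN // => /divr1_eq ->.
Qed.

Lemma character_exponent (z : C) psi :
    #|V|.-primitive_root z -> is_character psi ->
  exists k : V -> nat, forall x, psi x = z ^+ k x.
Proof.
move=> z_prim psiP.
exists (fun x => sval (prim_rootP z_prim (character_unity x psiP))) => x.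
by case: prim_rootP.
Qed.

(** One polynomial [P] serves for all [m]: this is what turns the Galois action
on the roots of unity into the maps [x |-> x *+ m] on the group. *)
Lemma character_sum_poly (z : C) psi (F : V -> int) :
    #|V|.-primitive_root z -> is_character psi ->
  exists P : {poly int}, forall m,
    (map_poly intr P).[z ^+ m] = \sum_x (F x)%:~R * psi (x *+ m).
Proof.
move=> z_prim psiP; have [k psi_k] := character_exponent z_prim psiP.
exists (\sum_x F x *: 'X^(k x)) => m.
rewrite rmorph_sum horner_sum; apply: eq_bigr => x _.
rewrite /= map_polyZ hornerZ map_polyXn hornerXn characterMn // psi_k.
by rewrite -!exprM mulnC.
Qed.

(** An integer is its own conjugate: [P - c] vanishes at [z], hence at
[z ^+ m]. *)
Lemma character_sum_conj psi (F : V -> int) (c : int) m :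
    is_character psi -> coprime #|V| m ->
    \sum_x (F x)%:~R * psi x = c%:~R ->
  \sum_x (F x)%:~R * psi (x *+ m) = c%:~R.
Proof.
move=> psiP V_m psi_c; have V_gt0 : (0 < #|V|)%N by apply/card_gt0P; exists 0.
have [z z_prim] := prim_root_exists C V_gt0.
have [P P_psi] := character_sum_poly F z_prim psiP.
have root_c (y : C) :
    root (map_poly intr (P - c%:P)) y = ((map_poly intr P).[y] == c%:~R).
  by rewrite rootE rmorphB /= map_polyC hornerD hornerN hornerC subr_eq0.
apply/eqP; rewrite -P_psi -root_c (root_prim_root_conj z_prim) //.
  by rewrite prim_root_exp_coprime // coprime_sym.
by rewrite root_c -[z]expr1 P_psi -psi_c; apply/eqP/eq_bigr => x _.
Qed.

(** Any primitive root is [z ^+ m] with [m] prime to [#|V|], and there the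
invariance of [F] gives back the same sum. *)
Lemma character_sum_int psi (F : V -> int) :
    is_character psi ->
    (forall m x, coprime #|V| m -> F (x *+ m) = F x) ->
  exists c : int, \sum_x (F x)%:~R * psi x = c%:~R.
Proof.
move=> psiP F_inv; have V_gt0 : (0 < #|V|)%N by apply/card_gt0P; exists 0.
have [z z_prim] := prim_root_exists C V_gt0.
have [P P_psi] := character_sum_poly F z_prim psiP.
apply: (horner_prim_root_int (P := P) z_prim) => y y_prim.
have [m Dy] := prim_rootP z_prim (prim_expr_order y_prim).
have V_m : coprime #|V| m.
  by rewrite coprime_sym -(prim_root_exp_coprime m z_prim) -Dy.
rewrite Dy P_psi [RHS](reindex _ (onW_bij _ (mulrn_bij V_m))).
by apply: eq_bigr => x _; rewrite F_inv.
Qed.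

End Characters.
(** * Matrices indexed by differences *)

Section ConvolutionMatrices.
Variables (C : numClosedFieldType) (V : finZmodType).
Variables (n : nat) (v : 'I_n -> V).
Hypothesis v_bij : bijective v.
Implicit Types (f g : V -> C) (psi : {ffun V -> C}).

Definition conv_mx f : 'M[C]_n := \matrix_(i, j) f (v i - v j).

Lemma sum_enumeration (G : V -> C) : \sum_i G (v i) = \sum_x G x.
Proof. by rewrite [RHS](reindex v) //; apply: onW_bij. Qed.

(** Both products are convolutions; the substitution [x |-> v i + v j - x]
exchanges them. *)
Lemma conv_mxC f g : comm_mx (conv_mx f) (conv_mx g).
Proof.
apply/matrixP=> i j; rewrite !mxE.
under eq_bigr do rewrite !mxE.
under [RHS]eq_bigr do rewrite !mxE.
rewrite (sum_enumeration (fun x => f (v i - x) * g (x - v j))).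
rewrite (sum_enumeration (fun x => g (v i - x) * f (x - v j))).
rewrite (reindex_inj (subrI (v i + v j))); apply: eq_bigr => x _ /=.
have -> : v i - (v i + v j - x) = x - v j.
  by rewrite opprB opprD addrCA [v i + _]addrA subrr add0r.
by rewrite [v i + _ - x]addrAC addrK mulrC.
Qed.

(** The conjugate transpose is again indexed by differences. *)
Lemma conv_mx_normal f : conv_mx f \is normalmx.
Proof.
apply/normalmxP.
have -> : ((conv_mx f) ^t*)%sesqui = conv_mx (fun x => (f (- x))^*).
  by apply/matrixP=> i j; rewrite !mxE opprB.
exact: conv_mxC.
Qed.

Lemma mul_row_conv_mx f psi : is_character psi ->
  (\row_j psi (v j)) *m conv_mx f =
  (\sum_x f x * psi x) *: \row_j psi (v j).
Proof.
move=> [_ psiD]; apply/rowP=> j; rewrite !mxE.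
under eq_bigr do rewrite !mxE.
rewrite (sum_enumeration (fun x => psi x * f (x - v j))).
rewrite (reindex_inj (addIr (v j))) mulr_suml; apply: eq_bigr => x _.
by rewrite addrK psiD mulrC mulrA.
Qed.

Lemma mul_conv_mx_col f psi : is_character psi ->
  conv_mx f *m (\row_j psi (v j))^T =
  (\sum_x f x * psi (- x)) *: (\row_j psi (v j))^T.
Proof.
move=> [_ psiD]; apply/colP=> i; rewrite !mxE.
under eq_bigr do rewrite !mxE.
rewrite (sum_enumeration (fun x => f (v i - x) * psi x)).
rewrite (reindex_inj (subrI (v i))) mulr_suml; apply: eq_bigr => x _.
by rewrite subKr addrC psiD mulrA.
Qed.

Lemma row_character_neq0 psi : is_character psi -> \row_j psi (v j) != 0.
Proof.
move=> [psi_neq0 _]; have [w _ wK] := v_bij.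
apply/eqP=> /rowP/(_ (w 0))/eqP; rewrite !mxE wK.
exact/negP/psi_neq0.
Qed.

Lemma eigenvalue_conv_mx_character f psi : is_character psi ->
  eigenvalue (conv_mx f) (\sum_x f x * psi x).
Proof.
move=> psiP; apply/eigenvalueP; exists (\row_j psi (v j)).
  exact: mul_row_conv_mx.
exact: row_character_neq0.
Qed.

(** Normal matrices are diagonalizable, and commuting diagonalizable matrices
are so in a common basis. *)
Lemma codiagonalizable_conv_mx (I : eqType) (s : seq I) (f : I -> V -> C) :
  codiagonalizable [seq conv_mx (f a) | a <- s].
Proof.
apply/codiagonalizableP; split=> [A B|A].
  move=> /mapP[a _ ->] /mapP[b _ ->].
  exact: conv_mxC.
move=> /mapP[a _ ->]; have /orthomx_spectralP Dfa := conv_mx_normal (f a).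
exists (spectralmx (conv_mx (f a))); first exact: spectral_unit.
apply/diagonalizable_forLR; first exact: spectral_unit.
by exists (spectral_diag (conv_mx (f a))); rewrite mxpoly.conjVmx ?spectral_unit.
Qed.

End ConvolutionMatrices.

(** Take a basis of common eigenvectors of all translations, as the columns of
[Q].  Some column [phi] has a nonzero pairing with [f].  Being multiplied by a
scalar under each translation, [phi] satisfies
[phi 0 * phi (y + z) = phi y * phi z], so [phi / phi 0] is a character. *)
Lemma characters_separate (C : numClosedFieldType) (V : finZmodType)
    (f : V -> C) x :
    f x != 0 ->
  exists2 psi : {ffun V -> C}, is_character psi & \sum_y f y * psi y != 0.
Proof.
move=> fx_neq0.
pose v : 'I_#|V| -> V := enum_val; have v_bij : bijective v := enum_val_bij _.
have [w vK wK] := v_bij.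
(* shift a acts on columns as translation by - a. *)
pose shift a := conv_mx (C := C) v (fun y => (y == a)%:R).
have [P P_unit /allP/= P_diag] :=
  codiagonalizable_conv_mx v_bij (enum V) (fun a y => (y == a)%:R : C).
pose Q := invmx P.
have Q_shift a : exists d, shift a *m Q = Q *m diag_mx d.
  have /P_diag : shift a \in [seq shift b | b <- enum V].
    by apply: map_f; rewrite mem_enum.
  case/(diagonalizable_forLR P_unit) => d ->; exists d.
  by rewrite mxpoly.conjVmx // mulmxK.
pose u := \row_j f (v j).
have [c uQc_neq0] : exists c, (u *m Q) 0 c != 0.
  apply/existsP; apply: contraNT fx_neq0; rewrite negb_exists => /forallP uQ0.
  have : u *m Q = 0.
    apply/rowP=> c; rewrite [RHS]mxE; apply/eqP.
    by rewrite -[_ == _]negbK uQ0.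
  move=> /(congr1 (mulmx^~ P)); rewrite mulmxKV // mul0mx => /rowP/(_ (w x)).
  by rewrite !mxE wK => ->.
pose phi y := Q (w y) c.
have phi_shift a : exists d, forall y, phi (y - a) = d * phi y.
  have [d /matrixP Dd] := Q_shift a; exists (d 0 c) => y.
  have := Dd (w y) c; rewrite mul_mx_diag mxE [RHS]mxE [RHS]mulrC => <-.
  rewrite (bigD1 (w (y - a))) //= mxE !wK subKr eqxx mul1r.
  rewrite big1 ?addr0 // => k k_neq; rewrite mxE wK; case: eqP => [Da|]; last first.
    by rewrite mul0r.
  by rewrite -Da subKr vK eqxx in k_neq.
have phiD y z : phi 0 * phi (y + z) = phi y * phi z.
  have [d Dd] := phi_shift (- z); move: (Dd y) (Dd 0); rewrite !opprK add0r.
  by move=> -> ->; rewrite mulrCA [RHS]mulrCA [phi 0 * _]mulrC.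
have Du : (u *m Q) 0 c = \sum_y f y * phi y.
  rewrite mxE -(sum_enumeration v_bij); apply: eq_bigr => i _.
  by rewrite mxE /phi vK.
have phi0_neq0 : phi 0 != 0.
  apply: contraNneq uQc_neq0 => phi0; rewrite Du big1 // => y _.
  have /eqP := phiD y y; rewrite phi0 mul0r eq_sym mulf_eq0 orbb => /eqP ->.
  by rewrite mulr0.
pose psi := [ffun y => phi y / phi 0].
have psiD y z : psi (y + z) = psi y * psi z.
  by rewrite !ffunE mulf_div -phiD -mulf_div divff // mul1r.
have psiP : is_character psi.
  split=> // y; have : psi 0 != 0 by rewrite ffunE divff ?oner_neq0.
  by rewrite -(subrr y) psiD mulf_eq0 => /norP[].
exists psi => //; under eq_bigr do rewrite ffunE mulrA.
by rewrite -mulr_suml -Du mulf_neq0 // invr_eq0.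
Qed.

(** Every character sum is an eigenvalue.  Conversely, pair an eigenvector [u]
for [a] with a character [psi] that it is not orthogonal to: moving the matrix
to the side of [psi] shows that [a] is a character sum, for the inverse of
[psi]. *)
Lemma integral_conv_mx (C : numClosedFieldType) (V : finZmodType) (n : nat)
    (v : 'I_n -> V) (v_bij : bijective v) (F : V -> int) :
  integral_spectrum (conv_mx v (fun x => (F x)%:~R : C)) <->
  forall psi : {ffun V -> C}, is_character psi ->
    exists c : int, \sum_x (F x)%:~R * psi x = c%:~R.
Proof.
split=> [F_int psi psiP | F_psi a /eigenvalueP[u uF u_neq0]].
  exact/F_int/eigenvalue_conv_mx_character.
have [w vK wK] := v_bij.
have [j uj_neq0] : exists j, u 0 j != 0 by apply/rV0Pn.
have [psi psiP u_psi] : exists2 psi : {ffun V -> C}, is_character psi &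
    \sum_x u 0 (w x) * psi x != 0.
  by apply: (characters_separate (x := v j)); rewrite vK.
have [c Dc] := F_psi _ (character_inv psiP); exists c; rewrite -Dc.
under eq_bigr do rewrite ffunE.
have Du : (u *m (\row_j psi (v j))^T) 0 0 = \sum_x u 0 (w x) * psi x.
  rewrite mxE -(sum_enumeration v_bij); apply: eq_bigr => i _.
  by rewrite !mxE vK.
have := congr1 (fun A => (A *m (\row_j psi (v j))^T) 0 0) uF.
rewrite -mulmxA mul_conv_mx_col // -scalemxAr -scalemxAl mxE [in RHS]mxE Du.
by move=> /(mulIf u_psi).
Qed.

(** With [h] the inverse of [x |-> x *+ m], the character sums of [F \o h] are
the conjugates of those of [F], which are integers; so [F \o h] and [F] have
the same character sums. *)
Lemma mulrn_invariant (C : numClosedFieldType) (V : finZmodType)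
    (F : V -> int) m x :
    (forall psi : {ffun V -> C}, is_character psi ->
      exists c : int, \sum_x (F x)%:~R * psi x = c%:~R) ->
  coprime #|V| m -> F (x *+ m) = F x.
Proof.
move=> F_psi V_m; have [h mK hK] := mulrn_bij V_m.
suff F_h y : (F (h y))%:~R - (F y)%:~R == 0 :> C.
  by apply/eqP; rewrite eq_sym -(eqr_int C) -subr_eq0 -{1}[x]mK F_h.
apply: contraT => F_h_neq0.
have [psi psiP] := characters_separate
  (f := fun z => (F (h z))%:~R - (F z)%:~R) F_h_neq0; have [c Dc] := F_psi psi psiP.
under eq_bigr do rewrite mulrBl.
rewrite sumrB Dc (reindex _ (onW_bij _ (mulrn_bij V_m))) /=.
under eq_bigr do rewrite mK.
by rewrite (character_sum_conj psiP V_m Dc) subrr eqxx.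
Qed.

Lemma pairwise_orthogonal_basis (C : numClosedFieldType) n (x : 'I_n -> 'rV[C]_n) :
    (forall i, x i != 0) ->
    (forall i j, i != j -> dotmx (x i) (x j) = 0) ->
  orthogonal_basis x.
Proof.
move=> x_neq0 x_orth; split=> //.
rewrite basisEfree subvf dimvf /dim /= size_map -cardE card_ord mul1n leqnn !andbT.
have x_dot i : dotmx (x i) (x i) != 0 by rewrite gt_eqF // dotmx_is_dotmx.
have x_inj : injective x.
  move=> i j x_ij; apply/eqP; apply: contraT => /x_orth/eqP.
  by rewrite x_ij (negPf (x_dot j)).
apply: (orthogonal_free (form := @dotmx C n)); apply/pairwise_orthogonalP; split.
  rewrite cons_uniq map_inj_uniq // enum_uniq andbT.
  by apply/imageP=> -[i _ /eqP]; rewrite eq_sym (negPf (x_neq0 i)).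
by move=> _ _ /imageP[i _ ->] /imageP[j _ ->] x_ij; apply: x_orth;
  apply: contraNneq x_ij => ->.
Qed.

(** * The generalized distance matrices *)

Theorem theorem4 (R : realType) (V : finZmodType) (n : nat) (v : 'I_n -> V)
    (v_bij : bijective v) (S : {set V}) (S_sym : [set - s | s in S] = S)
    (G_integral : integral_spectrum (adj_mx R[i] (cayley S) v))
    (k : (size (distances (cayley S))).-tuple int) :
  integral_spectrum (gen_dist_mx R[i] v k) /\
  (forall psi : 'I_n -> {ffun V -> R[i]},
     (forall i, is_character (psi i)) -> injective psi ->
     orthogonal_basis (fun i => \row_j psi i (v j)) /\
     (forall i, is_eigenvector (gen_dist_mx R[i] v k) (\row_j psi i (v j)))).
Proof.
pose F x := nth 0 k (index (gdist (cayley S) x 0) (distances (cayley S))).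
have -> : gen_dist_mx R[i] v k = conv_mx v (fun x => (F x)%:~R).
  by apply/matrixP=> i j; rewrite !mxE /F gdist_cayley.
have DA : adj_mx R[i] (cayley S) v = conv_mx v (fun x => ((x \in S)%:Z)%:~R).
  by apply/matrixP=> i j; rewrite !mxE.
rewrite {}DA in G_integral; move/(integral_conv_mx _ v_bij) in G_integral.
have S_m m x : coprime #|V| m -> (x *+ m \in S) = (x \in S).
  move=> /(mulrn_invariant x G_integral) [].
  by do 2!case: (_ \in S).
split=> [|psi psiP psi_inj].
  apply/(integral_conv_mx _ v_bij) => psi psiP; apply: character_sum_int => // m x V_m.
  by rewrite /F gdist_cayley_mulrn // => y; apply: S_m.
split=> [|i].
  apply: pairwise_orthogonal_basis => [i|i j ij]; first exact: row_character_neq0.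
  rewrite dotmxE mxE; under eq_bigr do rewrite !mxE.
  rewrite (sum_enumeration v_bij (fun x => psi i x * (psi j x)^*)).
  by rewrite character_orthogonal // (inj_eq psi_inj).
split; first exact: row_character_neq0.
by exists (\sum_x (F x)%:~R * psi i (- x)); apply: mul_conv_mx_col.
Qed.
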